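(* Consider two $M^{X}/G/1$ queues operating under the LCFS-p-repeat (with resampling) discipline, with the same Poisson batch-arrival rate $\lambda$ and the same batch-size distribution (mean $\mu$), and with generic i.i.d. service times $S$ and $S'$ respectively, both stable ($E(e^{-\lambda S})>\mu/(\mu+1)$ and $E(e^{-\lambda S'})>\mu/(\mu+1)$). Let $M$ and $M'$ be the maximum numbers of customers in the system during a busy period in the respective queues. If $E(e^{-\lambda S'})\geq E(e^{-\lambda S})$, then $M'\leq_{st}M$.
   Context: Under LCFS-p-repeat (with resampling), the customer who has been in the system the least amount of time is always served, newly arriving customers preempt the customer in service (customers within a batch are labeled arbitrarily and treated as arriving sequentially), service is non-idling, and a preempted service must be restarted from scratch when service recommences, with a new service time drawn independently from the service-time distribution. $X\geq_{st}Y$ iff $P(X>t)\geq P(Y>t)$ for all $t$. *)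

(* Defs.v *)
From HB Require Import structures.
From mathcomp Require Import all_boot all_order all_algebra.
From mathcomp Require Import all_classical all_reals all_analysis.
Set Implicit Arguments. Unset Strict Implicit. Unset Printing Implicit Defensive.
Import Order.TTheory GRing.Theory Num.Theory.
Local Open Scope classical_set_scope.
Local Open Scope ring_scope.

Definition mutually_independent d (T : measurableType d) (R : realType)
    (P : probability T R) (I : eqType) (Z : I -> T -> R) : Prop :=
  forall (F : seq I) (B : I -> set R), uniq F -> (forall i, measurable (B i)) ->
    P (\bigcap_(i in [set` F]) (Z i @^-1` B i)) =
    (\prod_(i <- F) P (Z i @^-1` B i))%E.

Definition has_law d (T : measurableType d) (R : realType)
    (P : probability T R) (Y : T -> R) (nu : probability R R) : Prop :=
  forall B : set R, measurable B -> P (Y @^-1` B) = nu B.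

Definition is_exponential d (T : measurableType d) (R : realType)
    (P : probability T R) (Y : T -> R) (lam : R) : Prop :=
  forall r : R, 0 <= r -> P (Y @^-1` `]r, +oo[%classic) = (expR (- (lam * r)))%:E.

Definition batch_law (R : realType) (beta : probability R R) (mu : R) : Prop :=
  beta [set (n%:R : R) | n in [set n : nat | (0 < n)%N]] = 1%E /\
  (\int[beta]_x (x%:E) = mu%:E)%E.

Definition service_law (R : realType) (nu : probability R R) : Prop :=
  nu `[0%R, +oo[%classic = 1%E.

Definition LST (R : realType) (lam : R) (nu : probability R R) : \bar R :=
  (\int[nu]_x (expR (- (lam * x)))%:E)%E.

(* Primitive random elements of one realization, all mutually independent:
   a k : time between the arrival of batch k and of batch k+1,
   X k : size of batch k (batch 0 opens the busy period at time 0),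
   S j : service-time sample drawn at the j-th service (re)start. *)
Definition prim_index := ((nat + nat) + nat)%type.

Definition prim_family (T : Type) (R : Type) (a X S : nat -> T -> R) :
    prim_index -> T -> R :=
  fun i => match i with
           | inl (inl k) => a k
           | inl (inr k) => X k
           | inr j => S j
           end.

Definition queue_model d (T : measurableType d) (R : realType)
    (P : probability T R) (lam : R) (beta nu : probability R R)
    (a X S : nat -> T -> R) : Prop :=
  [/\ forall i, measurable_fun setT (prim_family a X S i),
      mutually_independent P (prim_family a X S),
      forall k, is_exponential P (a k) lam,
      forall k, has_law P (X k) beta &
      forall j, has_law P (S j) nu].

Definition arr (R : realType) (a : nat -> R) (k : nat) : R := \sum_(i < k) a i.

(* State: (number in system, start epoch of current service,
           index of next batch to arrive, index of current service sample). *)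
Definition qstate (R : realType) := (nat * R * nat * nat)%type.

(* One event of the LCFS-p-repeat dynamics: either the customer in service
   completes before the next batch arrival (count - 1; the next service, if any,
   starts immediately with a fresh sample), or the next batch arrives first and
   preempts it (count + batch; the newest customer starts service with a fresh
   sample; the preempted service will be restarted with a new sample).
   Count 0 means the busy period has ended: the state is then frozen. *)
Definition qstep (R : realType) (a X S : nat -> R) (s : qstate R) : qstate R :=
  let: (n, tau, k, j) := s in
  if n == 0%N then s
  else if tau + S j < arr a k then (n.-1, tau + S j, k, j.+1)
  else ((n + Num.truncn (X k))%N, arr a k, k.+1, j.+1).

Definition qinit (R : realType) (X : nat -> R) : qstate R :=
  (Num.truncn (X 0%N), 0, 1%N, 0%N).

Definition count_after (R : realType) (a X S : nat -> R) (m : nat) : nat :=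
  (iter m (qstep a X S) (qinit X)).1.1.1.

Definition busy_max (R : realType) (a X S : nat -> R) : \bar R :=
  ereal_sup (range (fun m => ((count_after a X S m)%:R : R)%:E)).

Definition st_le d d' (T : measurableType d) (T' : measurableType d') (R : realType)
    (P' : probability T' R) (Y' : T' -> \bar R) (P : probability T R) (Y : T -> \bar R) :=
  forall t : R, (P' [set w | t%:E < Y' w] <= P [set w | t%:E < Y w])%E.

(* Main.v *)
(** At a service start with a further batch to come, memorylessness of the
    interarrival time makes the next event a completion with probability
    [p = E e^(-lam S)], whatever the past: resampling keeps the race between the
    fresh service time and the residual interarrival time independent of history.
    Hence the number in system, observed at events, is a walk that goes down by 1
    with probability [p] and up by a batch otherwise, frozen at 0. The probability
    of exceeding a level within [m] events is nondecreasing in the starting point;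
    moving mass from up-steps to down-steps therefore lowers it, so it is
    nonincreasing in [p]. Letting [m] tend to infinity gives the tail of the
    maximum. *)
Require Import Defs.
From HB Require Import structures.
From mathcomp Require Import all_boot all_order all_algebra.
From mathcomp Require Import all_classical all_reals all_analysis.
From mathcomp Require Import measurable_realfun ring.
Import Order.TTheory GRing.Theory Num.Theory.
Local Open Scope classical_set_scope.
Local Open Scope ring_scope.

Set Implicit Arguments.
Unset Strict Implicit.
Unset Printing Implicit Defensive.

(** * Independence of a coordinate from a history *)

Section sublaw.
Context d (T : measurableType d) (R : realType) (P : probability T R).
Context d' (U : measurableType d') (B : set T) (c : T -> U).
Hypotheses (mB : measurable B) (mc : measurable_fun setT c).

(* Unnormalized law of [c] on the event [B]. *)
Definition sublaw of measurable B & measurable_fun setT c : set U -> \bar R :=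
  fun C => P (B `&` c @^-1` C).

Local Notation m := (sublaw mB mc).

Let mpre C : measurable C -> measurable (c @^-1` C).
Proof. by move=> mC; rewrite -[_ @^-1` _]setTI; exact: mc. Qed.

Let sublaw0 : m set0 = 0%E.
Proof. by rewrite /sublaw preimage_set0 setI0 measure0. Qed.

Let sublaw_ge0 C : (0 <= m C)%E.
Proof. exact: measure_ge0. Qed.

Let sublaw_sigma_additive : semi_sigma_additive m.
Proof.
move=> F mF tF mUF; rewrite /sublaw preimage_bigcup setI_bigcupr.
apply: measure_semi_sigma_additive.
- by move=> n; apply: measurableI => //; exact: mpre.
- apply/trivIsetP => /= i j _ _ ij; rewrite setIACA -preimage_setI.
  by move/trivIsetP : tF => /(_ _ _ _ _ ij) ->//; rewrite preimage_set0 setI0.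
- by rewrite -setI_bigcupr -preimage_bigcup; apply: measurableI => //; exact: mpre.
Qed.

HB.instance Definition _ := isMeasure.Build _ _ _ m
  sublaw0 sublaw_ge0 sublaw_sigma_additive.

Let sublaw_fin : fin_num_fun m.
Proof.
move=> C mC; rewrite fin_num_measure//.
by apply: measurableI => //; exact: mpre.
Qed.

HB.instance Definition _ := Measure_isFinite.Build _ _ _ m sublaw_fin.

End sublaw.

Section history.
Context d (T : measurableType d) (R : realType) (P : probability T R).
Context (I : eqType) (Z : I -> T -> R).
Hypothesis mZ : forall i, measurable_fun setT (Z i).
Hypothesis indepZ : mutually_independent P Z.

Definition cylinder (J : pred I) : set (set T) :=
  [set A | exists F : seq I, exists B : I -> set R,
    [/\ {subset F <= J}, forall i, measurable (B i) &
        A = \bigcap_(i in [set` F]) (Z i @^-1` B i)]].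

(** The carrier remains [T]; only the sigma-algebra changes, to the one generated by the coordinates
    in [J]. Measurability over [history J] thus expresses dependence on those coordinates alone, and
    generic measurability lemmas apply to it. *)
Definition history (J : pred I) := g_sigma_algebraType (cylinder J).

Lemma cylinder_measurable J : cylinder J `<=` measurable.
Proof.
move=> _ [F [B [_ mB ->]]]; apply: fin_bigcap_measurable => // i _.
by rewrite -[_ @^-1` _]setTI; exact: mZ.
Qed.

Lemma cylinderT J : cylinder J setT.
Proof.
exists [::], (fun=> setT); split=> //.
by apply/seteqP; split=> // w _ i.
Qed.

Lemma cylinder_setI J : setI_closed (cylinder J).
Proof.
move=> _ _ [F [B [FJ mB ->]]] [F' [B' [FJ' mB' ->]]].
(* Padding with [setT] off the list lets both families of constraints live on the concatenated
   list. *)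
pose D (G : seq I) (C : I -> set R) i := if i \in G then C i else setT.
have mD G C i : (forall i, measurable (C i)) -> measurable (D G C i).
  by rewrite /D; case: ifP.
exists (F ++ F'), (fun i => D F B i `&` D F' B' i); split.
- by move=> i; rewrite mem_cat => /orP[/FJ|/FJ'].
- by move=> i; apply: measurableI; exact: mD.
- apply/seteqP; split=> [w [h h'] i _|w h].
    by rewrite /D; split; case: ifP => // iF; [exact: h|exact: h'].
  split=> i /= iF; have := h i; rewrite /= mem_cat iF ?orbT /D => /(_ isT).
    by rewrite iF => -[].
  by rewrite iF => -[].
Qed.

Lemma history_measurable J (A : set T) :
  measurable (A : set (history J)) -> measurable A.
Proof. exact: (smallest_sub (@sigma_algebra_measurable _ T) (@cylinder_measurable J)). Qed.

Lemma history_measurable_fun J (c : T -> R) :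
  measurable_fun setT (c : history J -> R) -> measurable_fun setT c.
Proof. by move=> mc _ B mB; apply: (@history_measurable J); exact: mc. Qed.

Lemma history_sub J K : {subset J <= K} ->
  forall A : set T, measurable (A : set (history J)) -> measurable (A : set (history K)).
Proof.
move=> JK; apply: sub_sigma_algebra2 => _ [F [B [FJ mB ->]]].
by exists F, B; split=> // i /FJ /JK.
Qed.

Lemma history_sub_fun J K : {subset J <= K} ->
  forall c : T -> R, measurable_fun setT (c : history J -> R) ->
  measurable_fun setT (c : history K -> R).
Proof. by move=> JK c mc _ B mB; apply: (history_sub JK); exact: mc. Qed.

Lemma history_coord (J : pred I) i : i \in J ->
  measurable_fun setT (Z i : history J -> R).
Proof.
move=> iJ _ B mB; rewrite setTI; apply: sub_sigma_algebra.
exists [:: i], (fun=> B); split=> [k|//|].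
  by rewrite inE => /eqP ->.
apply/seteqP; split=> [w Bw k|w /(_ i)]; first by rewrite /= inE => /eqP ->.
by apply; rewrite /= inE.
Qed.

(** As functions of [A], both sides are finite measures. Mutual independence makes them agree on
    cylinders, which form a pi-system, hence on the sigma-algebra they generate. *)
Lemma history_indep J i (A : set T) (C : set R) : i \notin J ->
  measurable (A : set (history J)) -> measurable C ->
  P (A `&` Z i @^-1` C) = (P A * P (Z i @^-1` C))%E.
Proof.
move=> iJ mA mC.
have mZC : measurable (Z i @^-1` C) by rewrite -[_ @^-1` _]setTI; exact: mZ.
have PZ0 : 0 <= fine (P (Z i @^-1` C)) by exact/fine_ge0/measure_ge0.
have PZE : P (Z i @^-1` C) = (fine (P (Z i @^-1` C)))%:E.
  by rewrite fineK// fin_num_measure.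
suff /(_ A mA) : forall D, <<s cylinder J >> D ->
    mrestr P mZC D = mscale (NngNum PZ0) P D.
  by rewrite /mrestr /mscale/= -PZE muleC.
apply: (g_sigma_algebra_measure_unique _ (@cylinder_measurable J)
  (fun=> setT) (fun=> cylinderT J)).
- by rewrite bigcup_const//; exists 0%N.
- exact: cylinder_setI.
- move=> _ [F [B [FJ mB ->]]].
  have iF : i \notin undup F by rewrite mem_undup; apply: contra iJ => /FJ.
  (* Mutual independence is applied to the list extended by [i], with [C] as its constraint; [undup]
     supplies the required uniqueness. *)
  pose D k := if k == i then C else B k.
  have := @indepZ (i :: undup F) D; rewrite big_cons /= iF undup_uniq.
  move=> /(_ isT) /=; have mD k : measurable (D k) by rewrite /D; case: ifP.
  move=> /(_ mD); rewrite /D eqxx.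
  have Di k : k \in undup F -> k == i = false.
    by move=> kF; apply/negbTE; apply: contraNN iF => /eqP <-.
  have -> : (\prod_(k <- undup F) P (Z k @^-1` (if k == i then C else B k)) =
      \prod_(k <- undup F) P (Z k @^-1` B k))%E.
    by rewrite !big_seq; apply: eq_bigr => k kF; rewrite Di.
  rewrite -(@indepZ (undup F) B) ?undup_uniq// => h.
  have FE : [set` undup F] = [set` F] by apply/seteqP; split=> k /=; rewrite mem_undup.
  rewrite [RHS]/mscale/= -PZE -FE -h /mrestr; congr (P _); apply/seteqP; split=> [w [Bw Cw] k|w h'].
    rewrite /= inE; case: eqP => [-> //|_ /= kF]; exact: Bw.
  split=> [k kF|]; last by have := h' i; rewrite /= eqxx; apply; rewrite inE eqxx.
  have := h' k; rewrite /= inE Di//= => /(_ kF); exact.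
- by move=> _; rewrite /= /mrestr setTI ltey_eq fin_num_measure.
Qed.

Definition coord_law i := sublaw P measurableT (mZ i).

Lemma coord_lawE i C : coord_law i C = P (Z i @^-1` C).
Proof. by rewrite /coord_law /sublaw setTI. Qed.

HB.instance Definition _ i := FiniteMeasure.on (coord_law i).

(** This stands in for conditioning on the past: on [B], the pair formed by [c] and the fresh
    coordinate has a product law. [history_indep] gives this on rectangles, and uniqueness of the
    product measure extends it. *)
Lemma history_joint (J : pred I) i (B : set T) (c : T -> R) (mB : measurable B)
    (mc : measurable_fun setT c) (E : set (R * R)) :
  i \notin J -> measurable (B : set (history J)) ->
  measurable_fun setT (c : history J -> R) -> measurable E ->
  (sublaw P mB mc \x coord_law i)%E E =
  P (B `&` (fun w => (c w, Z i w)) @^-1` E).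
Proof.
move=> iJ hB hc mE.
have mcZ : measurable_fun setT (fun w => (c w, Z i w)).
  by apply: measurable_fun_pair => //; exact: mZ.
rewrite -[RHS]/(sublaw P mB mcZ E).
apply: product_measure_unique => // C D mC mD.
rewrite /= /coord_law /sublaw setTI -(history_indep iJ)//.
  by congr (P _); rewrite -setIA.
by apply: measurableI => //; rewrite -[_ @^-1` _]setTI; exact: hc.
Qed.
End history.

(** * The race between a service and an exponential arrival *)

Lemma measurable_set_ltr d (T : measurableType d) (R : realType) (f g : T -> R) :
  measurable_fun setT f -> measurable_fun setT g ->
  measurable [set w | f w < g w].
Proof.
move=> mf mg; have mgf : measurable_fun setT (g \- f) by exact: measurable_funB.
have -> : [set w | f w < g w] = setT `&` (g \- f) @^-1` `]0, +oo[%classic.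
  rewrite setTI; apply/seteqP; split=> w /=;
  by rewrite in_itv/= andbT subr_gt0.
exact: mgf.
Qed.

Section discount.
Context (R : realType) (lam : R).

(* The truncation at 0 makes [discount] the exponential tail at every real,
   negative ones included. *)
Definition discount (x : R) : R := expR (- (lam * Num.max x 0)).

Lemma discount_ge0 x : 0 <= discount x. Proof. exact: expR_ge0. Qed.

Lemma measurable_discount : measurable_fun setT discount.
Proof.
apply: measurableT_comp => //; apply: measurableT_comp => //.
apply: measurable_funM => //.
exact: (measurable_maxr (f := id) (g := cst 0)).
Qed.

Lemma discountD x y : 0 <= x -> 0 <= y ->
  discount (x + y) = discount x * discount y.
Proof.
by move=> x0 y0; rewrite /discount !max_l ?addr_ge0// mulrDr opprD expRD.
Qed.

(** For negative [x] the tail lies between the tail at 0, which is 1, and the total mass 1. *)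
Lemma is_exponential_discount d (T : measurableType d) (P : probability T R)
    (Y : T -> R) (x : R) : measurable_fun setT Y -> is_exponential P Y lam ->
  P (Y @^-1` `]x, +oo[) = (discount x)%:E.
Proof.
move=> mY Yexp; rewrite /discount; have [x0|x0] := leP 0 x; first exact: Yexp.
apply/eqP; rewrite mulr0 oppr0 expR0 eq_le probability_le1/=; last first.
  by rewrite -[_ @^-1` _]setTI; exact: mY.
have <- : P (Y @^-1` `]0, +oo[) = 1%E by rewrite Yexp// mulr0 oppr0 expR0.
apply: le_measure; rewrite ?inE; try by rewrite -[_ @^-1` _]setTI; exact: mY.
by move=> w /=; rewrite !in_itv/= !andbT; exact: lt_trans.
Qed.

End discount.

Section race.
Context d (T : measurableType d) (R : realType) (P : probability T R).
Context (I : eqType) (Z : I -> T -> R).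
Hypothesis mZ : forall i, measurable_fun setT (Z i).
Hypothesis indepZ : mutually_independent P Z.
Context (lam : R).

(** Integrate out [Z i] first: the section at [x] of the region above the diagonal is the half-line
    beyond [x], whose mass is [discount lam x]. *)
Lemma exponential_tail (J : pred I) i (B : set T) (c : T -> R)
    (mB : measurable B) (mc : measurable_fun setT c) :
  is_exponential P (Z i) lam -> i \notin J ->
  measurable (B : set (history Z J)) ->
  measurable_fun setT (c : history Z J -> R) ->
  P (B `&` [set w | c w < Z i w]) =
  (\int[sublaw P mB mc]_x (discount lam x)%:E)%E.
Proof.
move=> Zexp iJ hB hc.
pose E := [set xy : R * R | xy.1 < xy.2].
have mE : measurable E.
  by apply: measurable_set_ltr; [exact: measurable_fst|exact: measurable_snd].
rewrite -[LHS](history_joint mZ indepZ mB mc iJ hB hc mE).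
apply: eq_integral => x _ /=.
rewrite -(is_exponential_discount x (mZ i) Zexp) -(coord_lawE P mZ); congr (coord_law _ _ _ _).
apply/seteqP; split=> y; rewrite /xsection/= inE in_itv/= andbT//.
Qed.

(** The exponential turns the sum into a product, and Tonelli separates the factors because [Z i] is
    independent of the history carrying [B] and [c]. *)
Lemma discounted_sum (J : pred I) i (B : set T) (c : T -> R)
    (mB : measurable B) (mc : measurable_fun setT c)
    (mc' : measurable_fun setT (c \+ Z i)) :
  (forall w, 0 <= c w) -> (forall w, 0 <= Z i w) -> i \notin J ->
  measurable (B : set (history Z J)) ->
  measurable_fun setT (c : history Z J -> R) ->
  (\int[sublaw P mB mc']_x (discount lam x)%:E =
   \int[sublaw P mB mc]_x (discount lam x)%:E *
   \int[coord_law P mZ i]_x (discount lam x)%:E)%E.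
Proof.
move=> c0 Z0 iJ hB hc.
(* Truncating each summand makes [discount] multiplicative on the whole plane, while [h] still
   equals the sum at the nonnegative values actually taken. *)
pose h (xy : R * R) : R := Num.max xy.1 0 + Num.max xy.2 0.
have mh : measurable_fun setT h.
  by apply: measurable_funD;
    [apply: (measurable_maxr (f := fst) (g := cst 0))
    |apply: (measurable_maxr (f := snd) (g := cst 0))].
have mD : measurable_fun setT (fun x => (discount lam x)%:E).
  by apply/measurable_EFinP; exact: measurable_discount.
rewrite (eq_measure_integral
  (pushforward (sublaw P mB mc \x coord_law P mZ i)%E h)); last first.
  move=> C mC _; have mhC : measurable (h @^-1` C).
    by rewrite -[_ @^-1` _]setTI; exact: mh.
  apply: etrans (esym (history_joint mZ indepZ mB mc iJ hB hc mhC)).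
  congr (P _); apply/seteqP; split=> w; rewrite /= /h/= !max_l//.
rewrite ge0_integral_pushforward//; last by move=> *; rewrite lee_fin discount_ge0.
rewrite preimage_setT fubini_tonelli1//; last 2 first.
- exact: measurableT_comp.
- by move=> x; rewrite lee_fin discount_ge0.
have hE x y : discount lam (h (x, y)) = discount lam x * discount lam y.
  by rewrite /h discountD ?le_max ?lexx ?orbT// /discount /= -!maxA !maxxx.
transitivity (\int[sublaw P mB mc]_x ((discount lam x)%:E *
    \int[coord_law P mZ i]_y (discount lam y)%:E))%E.
  apply: eq_integral => x _; rewrite /fubini_F -ge0_integralZl//=.
  - by apply: eq_integral => y _; rewrite hE EFinM.
  - by move=> *; rewrite lee_fin discount_ge0.
  - by rewrite lee_fin discount_ge0.
rewrite ge0_integralZr//.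
  by move=> *; rewrite lee_fin discount_ge0.
by apply: integral_ge0 => *; rewrite lee_fin discount_ge0.
Qed.

(** This is memorylessness: the exponential tail at [c + Z j] factors into the tail at [c], which
    rebuilds the conditioning event, and the transform of [Z j]. *)
Lemma race (J : pred I) i j (B : set T) (c : T -> R) :
  is_exponential P (Z i) lam -> (forall w, 0 <= c w) -> (forall w, 0 <= Z j w) ->
  i \notin J -> j \notin J -> i != j ->
  measurable (B : set (history Z J)) ->
  measurable_fun setT (c : history Z J -> R) ->
  P (B `&` [set w | c w + Z j w < Z i w]) =
  (P (B `&` [set w | (c w < Z i w)%R]) *
   \int[coord_law P mZ j]_x (discount lam x)%:E)%E.
Proof.
move=> Zexp c0 Z0 iJ jJ ij hB hc.
have mB := history_measurable mZ hB; have mc := history_measurable_fun mZ hc.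
(* The sum [c + Z j] needs [j] revealed as well; the enlarged history still omits [i]. *)
pose K := [predU1 j & J].
have JK : {subset J <= K} by move=> k; rewrite inE => ->; rewrite orbT.
have iK : i \notin K by rewrite inE negb_or ij.
have hc' : measurable_fun setT (c \+ Z j : history Z K -> R).
  apply: measurable_funD; first exact: history_sub_fun hc.
  by apply: history_coord; rewrite inE eqxx.
have mc' := history_measurable_fun mZ hc'.
rewrite (exponential_tail mB mc' Zexp iK)//; last exact: history_sub hB.
by rewrite (discounted_sum mB mc mc' c0 Z0 jJ hB hc) -(exponential_tail mB mc Zexp iJ).
Qed.
End race.

(** * The embedded walk *)

Section embedded_walk.
Context (R : realType) (t : R) (b : nat -> \bar R).
Hypothesis b_ge0 : forall x, (0 <= b x)%E.
Hypothesis b_sum1 : (\sum_(0 <= x <oo) b x)%E = 1%E.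
Local Open Scope ereal_scope.

(* Probability that the walk started at [n] exceeds [t] within [m] steps. *)
Fixpoint exceed (p : R) (m n : nat) : \bar R :=
  if (t < n%:R)%R then 1 else
  match m with
  | 0 => 0
  | m'.+1 => if n == 0%N then 0 else
      p%:E * exceed p m' n.-1 +
      (1 - p)%:E * \sum_(0 <= x <oo) b x * exceed p m' (n + x)%N
  end.

Let mean_le1 (f : nat -> \bar R) : (forall n, 0 <= f n <= 1) ->
  0 <= \sum_(0 <= x <oo) b x * f x <= 1.
Proof.
move=> f01; apply/andP; split.
  by apply: nneseries_ge0 => x _ _; rewrite mule_ge0//; case/andP: (f01 x).
rewrite -b_sum1; apply: lee_nneseries => x *.
  by rewrite mule_ge0//; case/andP: (f01 x).
by rewrite -[leRHS]mule1 lee_wpmul2l//; case/andP: (f01 x).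
Qed.

(** First raise both values at weight [q']; then moving weight from [A] to the larger [C] adds
    [(q' - q) * (C - A)]. The bounds ensure finiteness, so that this difference makes sense. *)
Let mix_le (A A' C C' : \bar R) (q q' : R) : (0 <= q)%R -> (q <= q')%R ->
  (q' <= 1)%R -> 0 <= A -> C <= 1 -> A' <= A -> C' <= C -> A <= C ->
  q'%:E * A' + (1 - q')%:E * C' <= q%:E * A + (1 - q)%:E * C.
Proof.
move=> q0 qq' q1 A0 C1 A'A C'C AC.
apply: (@le_trans _ _ (q'%:E * A + (1 - q')%:E * C)).
  by apply: leeD; apply: lee_wpmul2l => //; rewrite lee_fin ?subr_ge0 ?(le_trans q0).
have Cfin : C \is a fin_num.
  by rewrite ge0_fin_numE ?(le_trans A0)// (le_lt_trans C1) ?ltry.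
have Afin : A \is a fin_num by rewrite ge0_fin_numE// (le_lt_trans (le_trans AC C1)) ?ltry.
move: AC; rewrite -(fineK Afin) -(fineK Cfin) lee_fin => AC.
rewrite -!EFinM -!EFinD lee_fin -subr_ge0.
rewrite [leRHS](_ : _ = (q' - q) * (fine C - fine A))%R; last by ring.
by rewrite mulr_ge0// subr_ge0.
Qed.

Lemma exceed_bound p m n : (0 <= p <= 1)%R -> 0 <= exceed p m n <= 1.
Proof.
move=> p01; elim: m n => [|m IH] n /=; case: ifP => _; rewrite ?lexx ?lee01//.
case: ifP => _; first by rewrite lexx lee01.
have /andP[A0 A1] := IH n.-1.
have /andP[C0 C1] := mean_le1 (fun x => IH (n + x)%N).
have /andP[p0 p1] := p01; have q0 : (0 <= 1 - p)%R by rewrite subr_ge0.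
rewrite adde_ge0 ?mule_ge0 ?lee_fin//=.
have -> : 1 = p%:E + (1 - p)%:E by rewrite -EFinD addrC subrK.
by apply: leeD; rewrite -[leRHS]mule1 lee_wpmul2l ?lee_fin.
Qed.

(** Common steps preserve the order of two starting points. Freezing at 0 is harmless: a walk at 0
    that fails the level test has value 0. *)
Lemma exceed_homo p m n n' : (0 <= p <= 1)%R -> (n <= n')%N ->
  exceed p m n <= exceed p m n'.
Proof.
move=> p01; elim: m n n' => [|m IH] n n' nn'.
all: have tnn' : (t < n%:R -> t < n'%:R)%R by move/lt_le_trans; apply; rewrite ler_nat.
  rewrite /=; case: (ltP t n%:R) => [/tnn' -> //|_].
  by case: ifP => // _; exact: lee01.
have := exceed_bound m.+1 n' p01; have := exceed_bound m.+1 n p01; rewrite /=.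
case: (ltP t n%:R) => [/tnn' -> //|_]; case: (ltP t n'%:R) => [_ /andP[]//|_].
case: eqP => [_ _ /andP[]//|/eqP n0 _ _].
rewrite ifF; last by apply/negbTE; rewrite -lt0n (leq_trans _ nn')// lt0n.
have /andP[p0 p1] := p01; have q0 : (0 <= 1 - p)%R by rewrite subr_ge0.
apply: leeD; apply: lee_wpmul2l; rewrite ?lee_fin//.
  by apply: IH; rewrite -!subn1 leq_sub2r.
apply: lee_nneseries => x *.
  by rewrite mule_ge0//; have /andP[] := @exceed_bound p m (n + x) p01.
by apply: lee_wpmul2l => //; apply: IH; rewrite leq_add2r.
Qed.

(** Induction on the horizon with [mix_le], whose last premise asks that a down-step be no better
    for exceeding than an average up-step. *)
Lemma exceed_antitone p p' m n : (0 <= p)%R -> (p <= p')%R -> (p' <= 1)%R ->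
  exceed p' m n <= exceed p m n.
Proof.
move=> p0 pp' p1.
have p01 : (0 <= p <= 1)%R by rewrite p0 (le_trans pp').
have p01' : (0 <= p' <= 1)%R by rewrite p1 (le_trans p0).
elim: m n => [|m IH] n //=; case: ifP => // _; case: eqP => // /eqP n0.
have b01 n' := exceed_bound m n' p01; have b01' n' := exceed_bound m n' p01'.
apply: mix_le => //.
- by case/andP: (b01 n.-1).
- by have /andP[] := mean_le1 (fun x => b01 (n + x)%N).
- apply: lee_nneseries => x *; last exact: lee_wpmul2l.
  by rewrite mule_ge0//; case/andP: (b01' (n + x)%N).
have /andP[A0 A1] := b01 n.-1.
have AE : exceed p m n.-1 = (fine (exceed p m n.-1))%:E.
  by rewrite fineK// ge0_fin_numE// (le_lt_trans A1) ?ltry.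
rewrite -[leLHS]mule1 -b_sum1 AE -nneseriesZl// -AE.
apply: lee_nneseries => x *; first by rewrite mule_ge0.
rewrite muleC; apply: lee_wpmul2l => //; apply: exceed_homo => //.
by rewrite (leq_trans (leq_pred _))// leq_addr.
Qed.
End embedded_walk.

(** * Runs of the queue *)

Section paths.
Context (R : realType) (t : R) (a X S : nat -> R).

(** The recursion peels off the first event rather than the last, so that it unfolds in step with
    [exceed]. *)
Fixpoint exceeds (m : nat) (s : qstate R) : bool :=
  (t < s.1.1.1%:R) || if m is m'.+1 then exceeds m' (qstep a X S s) else false.

Lemma exceedsP m s :
  reflect (exists2 i, (i <= m)%N & t < (iter i (qstep a X S) s).1.1.1%:R)
    (exceeds m s).
Proof.
elim: m s => [|m IH] s /=.
  rewrite orbF; apply: (iffP idP) => [ts|[i]]; first by exists 0%N.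
  by rewrite leqn0 => /eqP ->.
apply: (iffP orP) => [[ts|/IH[i im ti]]|[[|i] im ti]]; last 2 first.
- by left.
- by right; apply/IH; exists i; rewrite // -iterSr.
- by exists 0%N.
- by exists i.+1; rewrite ?iterSr.
Qed.

Lemma lt_busy_maxP :
  (t%:E < busy_max a X S)%E <-> exists m, exceeds m (qinit X).
Proof.
split=> [/ereal_sup_gt[_ [m _ <-]]|[m /exceedsP[i _ ti]]].
  by rewrite lte_fin => tm; exists m; apply/exceedsP; exists m.
apply: (@lt_le_trans _ _ (count_after a X S i)%:R%:E); first by rewrite lte_fin.
by apply: ereal_sup_ubound; exists i.
Qed.

Lemma exceeds_homo m m' s : (m <= m')%N -> exceeds m s -> exceeds m' s.
Proof.
by move=> mm' /exceedsP[i im ti]; apply/exceedsP; exists i => //; exact: leq_trans mm'.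
Qed.

End paths.

(** The domain is arbitrary because the lemma serves the sample space, its histories and the real
    line. Sublevel sets of the truncation are sublevel sets of [Y], and level sets are their
    differences. *)
Lemma measurable_truncn_preimage d (T : measurableType d) (R : realType)
    (Y : T -> R) x : measurable_fun setT Y -> measurable [set w | Num.truncn (Y w) = x].
Proof.
move=> mY; have mlt n : measurable [set w | (Num.truncn (Y w) <= n)%N].
  rewrite (_ : [set w | _] = [set w | Y w < n.+1%:R]).
    exact: (measurable_set_ltr (g := cst n.+1%:R)).
  by apply/seteqP; split=> w /=; rewrite truncn_le_nat.
case: x => [|x].
  rewrite (_ : [set w | _] = [set w | (Num.truncn (Y w) <= 0)%N])//.
  by apply/seteqP; split=> w /=; rewrite leqn0 => /eqP.
rewrite (_ : [set w | _] = [set w | (Num.truncn (Y w) <= x.+1)%N] `\`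
    [set w | (Num.truncn (Y w) <= x)%N]); first exact: measurableD.
apply/seteqP; split=> w /=; first by move=> ->; rewrite leqnn ltnn.
by move=> [le1 /negP]; rewrite -ltnNge => le2; apply/eqP; rewrite eqn_leq le1.
Qed.

(** * The queue observed at events follows the embedded walk *)

Section model.
Context d (T : measurableType d) (R : realType) (P : probability T R).
Context (lam p t : R) (b : nat -> \bar R) (a X S : nat -> T -> R).
Local Notation Z := (prim_family a X S).
Hypothesis mZ : forall i, measurable_fun setT (Z i).
Hypothesis indepZ : mutually_independent P Z.
Hypothesis a_exp : forall k, is_exponential P (a k) lam.
Hypothesis X_law : forall k x, P [set w | Num.truncn (X k w) = x] = b x.
Hypothesis S_ge0 : forall j w, 0 <= S j w.
Hypothesis S_discount :
  forall j, (\int[coord_law P mZ (inr j)]_x (discount lam x)%:E)%E = p%:E.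

Hypothesis p01 : 0 <= p <= 1.
Hypothesis b_sum1 : (\sum_(0 <= x <oo) b x)%E = 1%E.

Let b_ge0 x : (0 <= b x)%E.
Proof. by rewrite -(X_law 0%N) measure_ge0. Qed.

Let exceed_ge0 m n : (0 <= exceed t b p m n)%E.
Proof. by case/andP: (exceed_bound t b_ge0 b_sum1 m n p01). Qed.

Let ma k : measurable_fun setT (a k). Proof. exact: (mZ (inl (inl k))). Qed.
Let mX k : measurable_fun setT (X k). Proof. exact: (mZ (inl (inr k))). Qed.
Let mS j : measurable_fun setT (S j). Proof. exact: (mZ (inr j)). Qed.

(* Variables revealed once [k] interarrival times, [l] batch sizes and
   [j] service samples have been observed. *)
Definition past (k l j : nat) : pred prim_index := fun i =>
  match i with
  | inl (inl r) => (r < k)%N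
  | inl (inr r) => (r < l)%N
  | inr r => (r < j)%N
  end.

Lemma past_sub k l j k' l' j' : (k <= k')%N -> (l <= l')%N -> (j <= j')%N ->
  {subset past k l j <= past k' l' j'}.
Proof.
move=> kk ll jj [[r|r]|r]; rewrite /in_mem/= => /leq_trans; exact.
Qed.

Let arrival k w := arr (a^~ w) k.

Let m_arrival k : measurable_fun setT (arrival k).
Proof. by rewrite /arrival /arr; apply: measurable_sum => i; exact: ma. Qed.

Definition run_exceeds m n (tau : T -> R) k j : set T :=
  [set w | exceeds t (a^~ w) (X^~ w) (S^~ w) m (n, tau w, k, j)].

Lemma run_exceedsT m n tau k j : t < n%:R -> run_exceeds m n tau k j = setT.
Proof. by move=> tn; apply/seteqP; split=> // w _; case: m => [|m]; rewrite /run_exceeds/= tn. Qed.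

Lemma run_exceeds0 n tau k j : ~~ (t < n%:R) -> run_exceeds 0%N n tau k j = set0.
Proof. by move=> tn; apply/seteqP; split=> w //; rewrite /run_exceeds/= (negbTE tn). Qed.

Lemma run_exceedsS_empty m tau k j : ~~ (t < 0%:R) ->
  run_exceeds m.+1 0%N tau k j = run_exceeds m 0%N tau k j.
Proof. by move=> tn; apply/seteqP; split=> w; rewrite /run_exceeds/= (negbTE tn). Qed.

Let completes (tau : T -> R) k j : set T :=
  [set w | tau w + S j w < arrival k w].

(** The first event is split by the outcome of the race, and a preemption also by batch size, so
    that every piece resumes from a deterministic count. *)
Lemma run_exceedsS m n tau k j : ~~ (t < n%:R) -> n != 0%N ->
  run_exceeds m.+1 n tau k j =
  (completes tau k j `&` run_exceeds m n.-1 (tau \+ S j) k j.+1) `|`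
  \bigcup_x (~` completes tau k j `&` [set w | Num.truncn (X k w) = x] `&`
             run_exceeds m (n + x) (arrival k) k.+1 j.+1).
Proof.
move=> /negbTE tn /negbTE n0; apply/seteqP; split=> w.
  rewrite /run_exceeds /= tn n0 /=; case: ifPn => [c e|c e]; first by left.
  right; exists (Num.truncn (X k w)) => //; split=> //; split=> //; exact/negP.
rewrite /run_exceeds /= tn n0 /= => -[[c e]|[x _ [[c <-] e]]]; first by rewrite ifT.
by rewrite ifF//; apply/negbTE/negP.
Qed.

Let m_completes tau k j : measurable_fun setT tau -> measurable (completes tau k j).
Proof. by move=> mtau; apply: measurable_set_ltr => //; exact: measurable_funD. Qed.

Lemma measurable_run_exceeds m n tau k j : measurable_fun setT tau ->
  measurable (run_exceeds m n tau k j).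
Proof.
elim: m n tau k j => [|m IH] n tau k j mtau; have [tn|tn] := boolP (t < n%:R).
- by rewrite run_exceedsT.
- by rewrite run_exceeds0.
- by rewrite run_exceedsT.
have [n0|n0] := eqVneq n 0%N.
  by rewrite n0 run_exceedsS_empty -?n0//; exact: IH.
rewrite run_exceedsS//; apply: measurableU.
  apply: measurableI; first exact: m_completes.
  by apply: IH; exact: measurable_funD.
apply: bigcup_measurable => x _; apply: measurableI; last exact: IH.
apply: measurableI; first by apply: measurableC; exact: m_completes.
exact: measurable_truncn_preimage.
Qed.

(** Right after an arrival the elapsed time is 0. Inserting the almost sure event that the next
    interarrival time is positive gives the shape of [run_exceeds_prob] with [c] equal to 0. *)
Lemma interarrival_gt0 k (A : set T) : measurable A ->
  P (A `&` [set w | 0 < a k w]) = P A.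
Proof.
move=> mA; have mpos : measurable [set w | 0 < a k w].
  by apply: (measurable_set_ltr (f := cst 0)).
have P1 : P [set w | 0 < a k w] = 1%E.
  have := a_exp k (lexx 0); rewrite mulr0 oppr0 expR0 => <-; congr (P _).
  by apply/seteqP; split=> w /=; rewrite in_itv/= andbT.
have P0 : P (~` [set w | 0 < a k w]) = 0%E by rewrite probability_setC// P1 subee.
have mAC : measurable (A `&` ~` [set w | 0 < a k w]).
  by apply: measurableI => //; exact: measurableC.
have PA0 : P (A `&` ~` [set w | 0 < a k w]) = 0%E.
  by apply: subset_measure0 P0 => //; exact: measurableC.
rewrite -[in RHS](setIT A) -(setUv [set w | 0 < a k w]) setIUr measureU//.
- by rewrite -[LHS]adde0; congr (_ + _)%E.
- exact: measurableI.
- by rewrite setIACA setICr setI0.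
Qed.

(* [c] is the time elapsed between the arrival of batch [k] and the current
   service start: the interarrival time [a k] is known only to exceed [c]. *)
Lemma run_exceeds_prob m n k j (B : set T) (c : T -> R) :
  (forall w, 0 <= c w) ->
  measurable (B : set (history Z (past k k.+1 j))) ->
  measurable_fun setT (c : history Z (past k k.+1 j) -> R) ->
  (P (B `&` [set w | (c w < a k w)%R] `&`
      run_exceeds m n (arrival k \+ c)%R k.+1 j) =
   P (B `&` [set w | (c w < a k w)%R]) * exceed t b p m n)%E.
Proof.
elim: m n k j B c => [|m IH] n k j B c c0 hB hc.
  rewrite /=; case: ifPn => [tn|tn]; first by rewrite run_exceedsT// setIT mule1.
  by rewrite run_exceeds0// setI0 measure0 mule0.
have mB := history_measurable mZ hB; have mc := history_measurable_fun mZ hc.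
set C := [set w | c w < a k w].
have mC : measurable C by exact: measurable_set_ltr.
rewrite [exceed _ _ _ _ _]/=; have [tn|tn] := boolP (t < n%:R).
  by rewrite run_exceedsT// setIT mule1.
have [n0|n0] := eqVneq n 0%N.
  rewrite n0 in tn *; rewrite run_exceedsS_empty// IH//; congr (_ * _)%E.
  by case: (m) => [|m'] /=; rewrite (negbTE tn).
rewrite run_exceedsS//.
set D := completes _ _ _.
(* The epoch of batch [k] cancels, leaving a race inside the current interarrival time. *)
have DE : D = [set w | c w + S j w < a k w].
  rewrite /D /completes /arrival /arr; apply/seteqP; split=> w /=;
  by rewrite big_ord_recr/= -addrA ltrD2l.
have mD : measurable D by apply: m_completes; exact: measurable_funD.
have DC : D `<=` C.
  by rewrite DE => w /=; apply: le_lt_trans; rewrite lerDl.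
set Q := P (B `&` C).
have ak : inl (inl k) \notin past k k.+1 j by rewrite /in_mem/= ltnn.
have sj : inr j \notin past k k.+1 j by rewrite /in_mem/= ltnn.
(* Given that the interarrival time outlasts [c], the service wins the race with probability [p],
   whatever the history. *)
have QD : P (B `&` D) = (Q * p%:E)%E.
  rewrite DE -(S_discount j).
  exact: (race (i := inl (inl k)) (j := inr j) mZ indepZ (a_exp k) c0 (S_ge0 j) ak sj _ hB hc).
have Qfin : Q = (fine Q)%:E by rewrite fineK// fin_num_measure//; exact: measurableI.
have QU : P (B `&` C `\` D) = (Q * (1 - p)%:E)%E.
  rewrite measureD; try exact: measurableI; rewrite ?ltey_eq ?fin_num_measure//; try exact: measurableI.
  rewrite -(setIA B) (setIidr DC) -[LHS]/(Q - P (B `&` D))%E QD Qfin -!EFinM -EFinB; congr EFin; ring.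
have hB' : measurable (B : set (history Z (past k k.+1 j.+1))).
  by apply: history_sub hB; exact: past_sub.
have hc' : measurable_fun setT (c \+ S j : history Z (past k k.+1 j.+1) -> R).
  apply: measurable_funD; first by apply: history_sub_fun hc; exact: past_sub.
  by apply: (@history_coord _ _ _ _ Z _ (inr j)); rewrite /in_mem/=.
have /andP[p_ge0 p_le1] := p01.
pose V x := ~` D `&` [set w | Num.truncn (X k.+1 w) = x] `&`
  run_exceeds m (n + x) (arrival k.+1) k.+2 j.+1.
have mTr x : measurable [set w | Num.truncn (X k.+1 w) = x].
  exact: measurable_truncn_preimage.
have mV x : measurable (B `&` C `&` V x).
  apply: measurableI; first exact: measurableI.
  apply: measurableI; last exact: measurable_run_exceeds.
  by apply: measurableI => //; exact: measurableC.
have PV x : P (B `&` C `&` V x) = (Q * (1 - p)%:E * (b x * exceed t b p m (n + x)))%E.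
  (* [J] is what the race reveals, namely [a k] and [S j] on top of the past; [K] adds the size of
     the preempting batch, which is independent of [J]. *)
  pose J := past k.+1 k.+1 j.+1; pose K := past k.+1 k.+2 j.+1.
  have JK : {subset J <= K} by exact: past_sub.
  have hJa : measurable_fun setT (a k : history Z J -> R).
    by apply: (@history_coord _ _ _ _ Z J (inl (inl k))); rewrite /in_mem/=.
  have hJS : measurable_fun setT (S j : history Z J -> R).
    by apply: (@history_coord _ _ _ _ Z J (inr j)); rewrite /in_mem/=.
  have hJc : measurable_fun setT (c : history Z J -> R).
    by apply: history_sub_fun hc; exact: past_sub.
  have hJ : measurable (B `&` C `\` D : set (history Z J)).
    apply: measurableD; last first.
      by rewrite DE; apply: measurable_set_ltr => //; exact: measurable_funD.
    apply: measurableI; last exact: measurable_set_ltr.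
    by apply: history_sub hB; exact: past_sub.
  have hK : measurable ((B `&` C `\` D) `&` [set w | Num.truncn (X k.+1 w) = x]
      : set (history Z K)).
    apply: measurableI; first exact: (history_sub JK hJ).
    refine (@measurable_truncn_preimage _ (history Z K) _ (X k.+1) x _).
    by apply: (@history_coord _ _ _ _ Z K (inl (inr k.+1))); rewrite /in_mem/=.
  have nJ : inl (inr k.+1) \notin J by rewrite /in_mem/= ltnn.
  have mtr : measurable [set y : R | Num.truncn y = x].
    exact: (measurable_truncn_preimage (Y := id)).
  have PB1 : P ((B `&` C `\` D) `&` [set w | Num.truncn (X k.+1 w) = x]) =
      (Q * (1 - p)%:E * b x)%E.
    rewrite -QU -(X_law k.+1 x).
    exact: (history_indep (i := inl (inr k.+1)) mZ indepZ nJ hJ mtr).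
  rewrite muleA -PB1 /V !setIA -/(B `&` C `\` D).
  (* The service started at this arrival falls under the induction hypothesis with elapsed time
     0. *)
  rewrite -(interarrival_gt0 k.+1); last first.
    apply: measurableI; last exact: measurable_run_exceeds.
    exact: (history_measurable mZ hK).
  rewrite setIAC.
  have := IH (n + x)%N k.+1 j.+1 _ (cst 0) (fun=> lexx _) hK (measurable_cst _).
  rewrite (_ : arrival k.+1 \+ cst 0 = arrival k.+1); last first.
    by apply/funext => w /=; rewrite addr0.
  move=> ->; congr (_ * _)%E; rewrite interarrival_gt0//.
  exact: (history_measurable mZ hK).
(* After a completion the same interarrival time is still running, with elapsed time [c + S j]; the
   event [D] is exactly the new conditioning that [a k] exceeds it. *)
have PD : P (B `&` C `&` (D `&` run_exceeds m n.-1 ((arrival k \+ c) \+ S j) k.+1 j.+1)) =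
    (Q * p%:E * exceed t b p m n.-1)%E.
  rewrite setIA -(setIA B) (setIidr DC) -QD.
  have -> : (arrival k \+ c) \+ S j = arrival k \+ (c \+ S j).
    by apply/funext => w /=; rewrite addrA.
  rewrite DE (IH n.-1 k j.+1 B (c \+ S j))// => w.
  by rewrite addr_ge0.
have PVs : P (\bigcup_x (B `&` C `&` V x)) =
    (Q * (1 - p)%:E * \sum_(0 <= x <oo) (b x * exceed t b p m (n + x)))%E.
  rewrite measure_bigcup//.
    rewrite Qfin -EFinM -nneseriesZl.
      rewrite EFinM -Qfin (eq_eseriesl (Q := xpredT)) => [|x]; last by rewrite in_setT.
      by apply: eq_eseriesr => x _; exact: PV.
    by move=> x _; rewrite mule_ge0.
  move=> x y _ _ [w [[_ [[_ <-] _]] [_ [[_ <-] _]]]] //.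
rewrite setIUr setI_bigcupr measureU.
- apply: (etrans (congr2 +%E PD PVs)).
  rewrite -!muleA ge0_muleDr ?mule_ge0 ?nneseries_ge0 ?lee_fin ?subr_ge0//.
  by move=> x _ _; rewrite mule_ge0.
- apply: measurableI; first exact: measurableI.
  by apply: measurableI => //; apply: measurable_run_exceeds;
    do 2![apply: measurable_funD => //].
- by apply: bigcup_measurable => x _; exact: (mV x).
- by apply/seteqP; split=> // w [[_ [Dw _]] [x _ [_ [[]]]]].
Qed.
End model.

(** * The busy period from its opening batch *)

Section start.
Context d (T : measurableType d) (R : realType) (P : probability T R).
Context (lam p t : R) (b : nat -> \bar R) (a X S : nat -> T -> R).
Local Notation Z := (prim_family a X S).
Hypothesis mZ : forall i, measurable_fun setT (Z i).

Definition busy_exceeds m : set T :=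
  [set w | exceeds t (a^~ w) (X^~ w) (S^~ w) m (qinit (X^~ w))].

Lemma busy_exceedsE m : busy_exceeds m =
  \bigcup_x ([set w | Num.truncn (X 0%N w) = x] `&`
             run_exceeds t a X S m x (cst 0) 1%N 0%N).
Proof.
apply/seteqP; split=> w; last by move=> [x _ [<-]].
by move=> e; exists (Num.truncn (X 0%N w)).
Qed.

Lemma measurable_busy_exceeds m : measurable (busy_exceeds m).
Proof.
rewrite busy_exceedsE; apply: bigcup_measurable => x _; apply: measurableI.
  exact: (@measurable_truncn_preimage _ _ _ (X 0%N) x (mZ (inl (inr 0%N)))).
exact: measurable_run_exceeds.
Qed.

Lemma bigcup_busy_exceeds :
  \bigcup_m busy_exceeds m = [set w | (t%:E < busy_max (a^~ w) (X^~ w) (S^~ w))%E].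
Proof.
apply/seteqP; split=> w; first by move=> [m _ e]; apply/lt_busy_maxP; exists m.
by move=> /lt_busy_maxP[m e]; exists m.
Qed.

Lemma measurable_busy_max_tail :
  measurable [set w | (t%:E < busy_max (a^~ w) (X^~ w) (S^~ w))%E].
Proof.
rewrite -bigcup_busy_exceeds; apply: bigcup_measurable => m _.
exact: measurable_busy_exceeds.
Qed.

Lemma busy_exceeds_cvg : P (busy_exceeds m) @[m --> \oo] -->
  P [set w | (t%:E < busy_max (a^~ w) (X^~ w) (S^~ w))%E].
Proof.
rewrite -bigcup_busy_exceeds; apply: nondecreasing_cvg_mu.
- exact: measurable_busy_exceeds.
- by rewrite bigcup_busy_exceeds; exact: measurable_busy_max_tail.
- by move=> m n mn; apply/subsetPset => w; exact: exceeds_homo.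
Qed.

Hypothesis indepZ : mutually_independent P Z.
Hypothesis a_exp : forall k, is_exponential P (a k) lam.
Hypothesis X_law : forall k x, P [set w | Num.truncn (X k w) = x] = b x.
Hypothesis S_ge0 : forall j w, 0 <= S j w.
Hypothesis S_discount :
  forall j, (\int[coord_law P mZ (inr j)]_x (discount lam x)%:E)%E = p%:E.
Hypothesis p01 : 0 <= p <= 1.
Hypothesis b_sum1 : (\sum_(0 <= x <oo) b x)%E = 1%E.

(** Condition on the size of batch 0, then apply [run_exceeds_prob] at [k = 0] with elapsed time 0;
    the next batch has index 1, as in [qinit]. *)
Lemma busy_exceeds_prob m :
  P (busy_exceeds m) = (\sum_(0 <= x <oo) b x * exceed t b p m x)%E.
Proof.
have mtr x : measurable [set w | Num.truncn (X 0%N w) = x].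
  exact: (@measurable_truncn_preimage _ _ _ (X 0%N) x (mZ (inl (inr 0%N)))).
have mrun x : measurable ([set w | Num.truncn (X 0%N w) = x] `&`
             run_exceeds t a X S m x (cst 0) 1%N 0%N).
  by apply: measurableI => //; exact: measurable_run_exceeds.
rewrite busy_exceedsE measure_bigcup//; last first.
  by move=> x y _ _ [w [[<- _] [<- _]]].
rewrite (eq_eseriesl (Q := xpredT)) => [|x]; last by rewrite in_setT.
apply: eq_eseriesr => x _.
apply: (etrans (esym (interarrival_gt0 mZ a_exp 0%N (mrun x)))); rewrite setIAC.
have hB : measurable ([set w | Num.truncn (X 0%N w) = x] : set (history Z (past 0%N 1%N 0%N))).
  refine (@measurable_truncn_preimage _ (history Z (past 0%N 1%N 0%N)) _ (X 0%N) x _).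
  exact: (@history_coord _ _ _ _ Z _ (inl (inr 0%N))).
have := run_exceeds_prob t indepZ a_exp X_law S_ge0 S_discount p01 b_sum1 m x
   (fun=> lexx _) hB (measurable_cst _).
rewrite [X in run_exceeds _ _ _ _ _ _ X](_ : _ = cst 0); last first.
  by apply/funext => w /=; rewrite /arr big_ord0 addr0.
move=> ->; congr (_ * _)%E.
by rewrite (interarrival_gt0 mZ a_exp)// X_law.
Qed.
End start.

(** * From the laws of the primitives to the tail of the maximum *)

Lemma service_law_discount (R : realType) (lam : R) (nu : probability R R) :
  service_law nu -> LST lam nu = (\int[nu]_x (discount lam x)%:E)%E.
Proof.
move=> nu0; have N0 : nu (~` `[0, +oo[%classic) = 0%E.
  by rewrite probability_setC// (nu0 : nu _ = 1%E) subee.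
apply: ge0_ae_eq_integral => //.
- apply/measurable_EFinP; apply: measurableT_comp => //; apply: measurableT_comp => //.
- by apply/measurable_EFinP; exact: measurable_discount.
- by move=> x _; rewrite lee_fin expR_ge0.
(* The two integrands can differ only on the negative half-line, which is null for [nu]. *)
exists (~` `[0, +oo[%classic); split.
- exact: measurableC.
- exact: N0.
- apply: subsetC => x /=; rewrite in_itv/= andbT => x0 _.
  by rewrite /discount max_l.
Qed.

Lemma LST_fine (R : realType) (lam : R) (nu : probability R R) : 0 < lam ->
  service_law nu -> LST lam nu = (fine (LST lam nu))%:E /\ 0 <= fine (LST lam nu) <= 1.
Proof.
move=> lam0 nu0; have : (0 <= LST lam nu <= 1)%E.
  rewrite service_law_discount// integral_ge0/=; last first.
    by move=> x _; rewrite lee_fin expR_ge0.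
  have <- : (\int[nu]_x (cst 1%E) x = 1 :> \bar R)%E.
    by rewrite integral_cst// mul1e; exact: probability_setT.
  apply: ge0_le_integral => //.
  - by move=> x _; rewrite lee_fin expR_ge0.
  - by apply/measurable_EFinP; exact: measurable_discount.
  - move=> x _; rewrite lee_fin /discount -expR0 ler_expR oppr_le0.
    by apply: mulr_ge0; [exact: ltW|rewrite le_max lexx orbT].
by case: (LST lam nu) => [r||]//=; rewrite ?leye_eq ?leeNy_eq//= ?andbF// lee_fin lee_fin.
Qed.

Lemma sum_truncn_preimage (R : realType) (beta : probability R R) :
  (\sum_(0 <= x <oo) beta [set y | Num.truncn y = x])%E = 1%E.
Proof.
have mtr x : measurable [set y : R | Num.truncn y = x].
  exact: (measurable_truncn_preimage (Y := id)).
rewrite -(probability_setT beta).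
rewrite (_ : setT = \bigcup_x [set y : R | Num.truncn y = x]).
  apply/esym; apply: measure_semi_bigcup => //.
    by move=> x y _ _ [z [<- <-]].
  exact: bigcup_measurable.
by apply/seteqP; split=> // y _; exists (Num.truncn y).
Qed.

(* Service samples are nonnegative only almost surely; their positive parts are
   nonnegative everywhere. *)
Definition positive_part (T : Type) (R : realType) (S : nat -> T -> R) j w :=
  Num.max (S j w) 0.

Section queue.
Context d (T : measurableType d) (R : realType) (P : probability T R).
Context (lam : R) (beta nu : probability R R) (a X S : nat -> T -> R).
Hypothesis lam0 : 0 < lam.
Hypothesis nu0 : service_law nu.
Hypothesis model : queue_model P lam beta nu a X S.

Let S' := positive_part S.

Let mZ i : measurable_fun setT (prim_family a X S i).
Proof. by have [] := model. Qed.

Let mZ' i : measurable_fun setT (prim_family a X S' i).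
Proof.
case: i => [i|j]; first exact: (mZ (inl i)).
by apply: (measurable_maxr (f := S j) (g := cst 0)) => //; exact: (mZ (inr j)).
Qed.

Let m_max0 : measurable_fun setT (fun y : R => Num.max y 0).
Proof. exact: (measurable_maxr (f := id) (g := cst 0)). Qed.

Let indepZ' : mutually_independent P (prim_family a X S').
Proof.
have [_ indepZ _ _ _] := model => F B uF mB.
(* Truncating a service sample is absorbed into its constraint set, so independence of the original
   family applies. *)
pose B' (i : prim_index) := if i is inr _ then (fun y => Num.max y 0) @^-1` B i else B i.
have mB' i : measurable (B' i).
  case: i => [i|j]; first exact: mB.
  by rewrite /B' -[_ @^-1` _]setTI; exact: m_max0.
have E i : prim_family a X S' i @^-1` B i = prim_family a X S i @^-1` B' i by case: i.
rewrite (eq_bigcapr (fun i _ => E i)) indepZ//.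
by apply: eq_bigr => i _; rewrite E.
Qed.

Let S'_discount j :
  (\int[coord_law P mZ' (inr j)]_x (discount lam x)%:E)%E = (fine (LST lam nu))%:E.
Proof.
have [_ _ _ _ S_law] := model.
have mD : measurable_fun setT (fun x => (discount lam x)%:E).
  by apply/measurable_EFinP; exact: measurable_discount.
rewrite -(LST_fine lam0 nu0).1 service_law_discount//.
(* The truncated sample has the law of [nu] pushed through the positive part, and [discount] is
   unchanged by that map. *)
rewrite (eq_measure_integral (pushforward nu (fun y : R => Num.max y 0))).
  rewrite ge0_integral_pushforward//; last by move=> x _; rewrite lee_fin expR_ge0.
  rewrite preimage_setT; apply: eq_integral => x _.
  by rewrite /= /discount -maxA maxxx.
move=> C mC _; have mC' : measurable ((fun y : R => Num.max y 0) @^-1` C).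
  by rewrite -[_ @^-1` _]setTI; exact: m_max0.
exact: (etrans (coord_lawE P mZ' (inr j) C) (S_law j _ mC')).
Qed.

Let service_ge0_ae : {ae P, forall w, forall j, 0 <= S j w}.
Proof.
have [_ _ _ _ S_law] := model.
have mge0 j : measurable (S j @^-1` `[0, +oo[%classic).
  by rewrite -[_ @^-1` _]setTI; exact: (mZ (inr j)).
have N0 j : P (~` (S j @^-1` `[0, +oo[%classic)) = 0%E.
  by rewrite probability_setC// S_law// (nu0 : nu _ = 1%E) subee.
apply: ae_foralln => j; exists (~` (S j @^-1` `[0, +oo[%classic)); split.
- exact: measurableC.
- exact: N0.
- by apply: subsetC => w /=; rewrite in_itv/= andbT.
Qed.

(** Passing to positive parts changes the paths only on a null set; for them the finite-horizon
    probabilities are those of the walk, and continuity from below gives the limit. *)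
Lemma busy_max_tail_cvg (t : R) :
  (\sum_(0 <= x <oo) beta [set y | Num.truncn y = x] *
     exceed t (fun x => beta [set y | Num.truncn y = x]) (fine (LST lam nu)) m x)%E
    @[m --> \oo] -->
  P [set w | (t%:E < busy_max (a^~ w) (X^~ w) (S^~ w))%E].
Proof.
have [_ _ a_exp X_law S_law] := model.
have -> : P [set w | (t%:E < busy_max (a^~ w) (X^~ w) (S^~ w))%E] =
          P [set w | (t%:E < busy_max (a^~ w) (X^~ w) (S'^~ w))%E].
  have [N [mN PN0 SN]] := service_ge0_ae.
  have m1 := measurable_busy_max_tail t mZ; have m2 := measurable_busy_max_tail t mZ'.
  (* Adjoining the null set [N] to both events makes them equal, since off [N] the samples coincide
     with their positive parts. *)
  rewrite -[LHS](measureU0 m1 mN PN0) -[RHS](measureU0 m2 mN PN0); congr (P _).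
  have SE w : ~ N w -> S'^~ w = S^~ w.
    move=> Nw; apply/funext => j; rewrite /S' /positive_part max_l//.
    by have : forall j, 0 <= S j w by apply: contrapT => /SN.
  apply/seteqP; split=> w -[|Nw]; try by right.
    by have [Nw|Nw] := pselect (N w); [right|left; rewrite /= SE].
  by have [Nw|Nw] := pselect (N w); [right|left; rewrite /= -(SE w)].
have [p_fine p01] := LST_fine lam0 nu0.
have X'_law k x : P [set w | Num.truncn (X k w) = x] = beta [set y | Num.truncn y = x].
  by apply: X_law; exact: (measurable_truncn_preimage (Y := id)).
have S'_ge0 j w : 0 <= S' j w by rewrite /S' /positive_part le_max lexx orbT.
under eq_fun => m do rewrite -(busy_exceeds_prob t indepZ' a_exp X'_law S'_ge0
  S'_discount p01 (sum_truncn_preimage beta)).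
exact: busy_exceeds_cvg.
Qed.
End queue.

(** * Comparison of the two queues *)

Theorem theorem4 (R : realType) (d d' : measure_display)
    (T : measurableType d) (T' : measurableType d')
    (P : probability T R) (P' : probability T' R)
    (lam mu : R) (beta nu nu' : probability R R)
    (a X S : nat -> T -> R) (a' X' S' : nat -> T' -> R) :
  0 < lam ->
  batch_law beta mu ->
  service_law nu -> service_law nu' ->
  queue_model P lam beta nu a X S ->
  queue_model P' lam beta nu' a' X' S' ->
  ((mu / (mu + 1))%:E < LST lam nu)%E ->
  ((mu / (mu + 1))%:E < LST lam nu')%E ->
  (LST lam nu <= LST lam nu')%E ->
  st_le P' (fun w => busy_max (a'^~ w) (X'^~ w) (S'^~ w))
        P  (fun w => busy_max (a^~ w) (X^~ w) (S^~ w)).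
Proof.
move=> lam0 _ nu0 nu'0 M M' _ _ LL t.
have [Ep /andP[p0 p1]] := LST_fine lam0 nu0.
have [Ep' /andP[p'0 p'1]] := LST_fine lam0 nu'0.
have pp' : fine (LST lam nu) <= fine (LST lam nu') by rewrite -lee_fin -Ep -Ep'.
have cvg := busy_max_tail_cvg lam0 nu0 M (t := t).
have cvg' := busy_max_tail_cvg lam0 nu'0 M' (t := t).
rewrite -(cvg_lim _ cvg)// -(cvg_lim _ cvg')//.
(* The tails are limits of finite-horizon sums with the same batch weights, so it suffices to
   compare [exceed] at the two transforms, for each horizon and opening batch size. *)
apply: lee_lim; [by apply/cvg_ex; eexists; exact: cvg'|by apply/cvg_ex; eexists; exact: cvg|].
apply: nearW => m; apply: lee_nneseries => x _ *.
  apply: mule_ge0 => //.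
  by have /andP[] := exceed_bound t (fun x => measure_ge0 beta _)
    (sum_truncn_preimage beta) m x (introT andP (conj p'0 p'1)).
apply: lee_wpmul2l => //; apply: exceed_antitone => //.
exact: sum_truncn_preimage.
Qed.
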